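(* Let $A$ be a self-adjoint matrix in $M_n(\mathbb{C})$. Then the Schur multiplier norm satisfies $\|A\|_S\le 1$ if and only if there exists a positive matrix $P$ in $M_n(\mathbb{C})$ such that $$-P\le A\le P\quad\text{and}\quad \|\mathrm{diag}(P)\|_\infty\le 1.$$
   Context: $M_n(\mathbb{C})$ is the set of complex $n\times n$ matrices and $\|\cdot\|_\infty$ on matrices is the operator norm (with respect to Euclidean norms). The Schur product of $X,Y$ in $M_n(\mathbb{C})$ is the entrywise product $(X\circ Y)_{(i,j)}=X_{(i,j)}Y_{(i,j)}$, and the Schur multiplier norm is $\|X\|_S=\sup\{\|X\circ Y\|_\infty : Y\in M_n(\mathbb{C}),\ \|Y\|_\infty\le 1\}$. ''Positive'' means positive semidefinite, and for self-adjoint $C,D$ the relation $C\le D$ means $D-C$ is positive semidefinite. $\mathrm{diag}(P)$ is the diagonal of $P$, and $\|\mathrm{diag}(P)\|_\infty=\max_j|P_{(j,j)}|$. *)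

(* Defs.v *)
From HB Require Import structures.
From mathcomp Require Import all_boot all_order all_algebra.
From mathcomp Require Import complex.
From mathcomp Require Import boolp classical_sets reals.

Set Implicit Arguments.
Unset Strict Implicit.
Unset Printing Implicit Defensive.

Import Order.TTheory GRing.Theory Num.Theory.

Local Open Scope ring_scope.
Local Open Scope classical_set_scope.
Local Open Scope complex_scope.
Local Open Scope sesquilinear_scope.

(* The modulus on R[i] is taken with values in R ([Normc.normc]); the library's
   [`|z|] on R[i] has values in R[i] itself. *)
Definition cmod (R : realType) (z : R[i]) : R := Normc.normc z.

Definition euclid_norm (R : realType) (n : nat) (v : 'cV[R[i]]_n) : R :=
  Num.sqrt (\sum_(i < n) cmod (v i 0) ^+ 2).

(* [sup] is 0 on a set without supremum; [has_sup_opnorm] and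
   [has_sup_schur_norm] below show that this never happens here, n = 0
   included. *)
Definition opnorm (R : realType) (n : nat) (X : 'M[R[i]]_n) : R :=
  sup [set euclid_norm (X *m v) | v in [set v : 'cV[R[i]]_n | euclid_norm v <= 1]].

Definition schur_prod (R : realType) (n : nat) (X Y : 'M[R[i]]_n) : 'M[R[i]]_n :=
  \matrix_(i, j) (X i j * Y i j).

Definition schur_norm (R : realType) (n : nat) (X : 'M[R[i]]_n) : R :=
  sup [set opnorm (schur_prod X Y) | Y in [set Y : 'M[R[i]]_n | opnorm Y <= 1]].

(* In the order of R[i], [0 <= z] says that z is real and nonnegative. *)
Definition psdmx (R : realType) (n : nat) (P : 'M[R[i]]_n) : Prop :=
  P \is hermsymmx /\
  forall v : 'cV[R[i]]_n, 0 <= (v ^t* *m P *m v) 0 0.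

Definition loewner_le (R : realType) (n : nat) (C D : 'M[R[i]]_n) : Prop :=
  psdmx (D - C).

Definition diag_norm (R : realType) (n : nat) (P : 'M[R[i]]_n) : R :=
  \big[Num.max/0]_(j < n) cmod (P j j).

Section Boundedness.
Variables (R : realType) (n : nat).
Implicit Types (X Y : 'M[R[i]]_n) (v : 'cV[R[i]]_n).

Lemma cmod_ge0 (z : R[i]) : 0 <= cmod z.
Proof. by case: z => a b; rewrite /cmod /= sqrtr_ge0. Qed.

Lemma cmod_norm (z : R[i]) : (cmod z)%:C = `|z|.
Proof. by []. Qed.

Lemma cmodM (z w : R[i]) : cmod (z * w) = cmod z * cmod w.
Proof. exact: Normc.normcM. Qed.

Lemma cmod0 : cmod (0 : R[i]) = 0.
Proof. exact: Normc.normc0. Qed.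

Lemma cmod1 : cmod (1 : R[i]) = 1.
Proof. exact: Normc.normc1. Qed.

Lemma cmod_sum (f : 'I_n -> R[i]) : cmod (\sum_j f j) <= \sum_j cmod (f j).
Proof.
elim/big_ind2 : _ => [|x a y b lxa lyb|//]; first by rewrite cmod0.
exact: le_trans (le_normcD _ _) (lerD lxa lyb).
Qed.

Lemma cmod_le_euclid v i : cmod (v i 0) <= euclid_norm v.
Proof.
rewrite -[leLHS]ger0_norm ?cmod_ge0// -sqrtr_sqr ler_wsqrtr//.
by rewrite (bigD1 i)//= lerDl sumr_ge0// => j _; rewrite sqr_ge0.
Qed.

Lemma euclid_norm0 : euclid_norm (0 : 'cV[R[i]]_n) = 0.
Proof.
by rewrite /euclid_norm big1 ?sqrtr0// => i _; rewrite mxE cmod0 expr0n.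
Qed.

Lemma euclid_norm_delta j : euclid_norm (delta_mx j 0 : 'cV[R[i]]_n) = 1.
Proof.
rewrite /euclid_norm (bigD1 j)//= big1 ?addr0 => [|i /negPf ij].
  by rewrite mxE !eqxx cmod1 expr1n sqrtr1.
by rewrite mxE ij cmod0 expr0n.
Qed.

Definition rowsum_bound X : R :=
  Num.sqrt (\sum_i (\sum_j cmod (X i j)) ^+ 2).

Lemma rowsum_bound_ub X v :
  euclid_norm v <= 1 -> euclid_norm (X *m v) <= rowsum_bound X.
Proof.
move=> v1; apply/ler_wsqrtr/ler_sum => i _.
rewrite lerXn2r ?nnegrE ?cmod_ge0 ?sumr_ge0// => [j _|].
  exact: cmod_ge0.
rewrite mxE; apply: le_trans (cmod_sum _) _; apply: ler_sum => j _.
by rewrite cmodM ler_piMr ?cmod_ge0// (le_trans (cmod_le_euclid _ _)).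
Qed.

Lemma has_sup_opnorm X :
  has_sup [set euclid_norm (X *m v) | v in [set v | euclid_norm v <= 1]].
Proof.
split; first by exists (euclid_norm (X *m 0)), 0 => //=; rewrite euclid_norm0.
by exists (rowsum_bound X) => _ [v /= v1 <-]; exact: rowsum_bound_ub.
Qed.

Lemma opnorm_ub X v : euclid_norm v <= 1 -> euclid_norm (X *m v) <= opnorm X.
Proof. by move=> v1; apply: (sup_upper_bound (has_sup_opnorm X)); exists v. Qed.

Lemma opnorm_le X (r : R) :
  (forall v, euclid_norm v <= 1 -> euclid_norm (X *m v) <= r) -> opnorm X <= r.
Proof.
move=> Xr; apply: ge_sup; first by case: (has_sup_opnorm X).
by move=> _ [v /= v1 <-]; exact: Xr.
Qed.

Lemma cmod_le_opnorm X i j : cmod (X i j) <= opnorm X.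
Proof.
have := @opnorm_ub X (delta_mx j 0); rewrite euclid_norm_delta lexx => /(_ isT).
apply: le_trans; rewrite -colE.
by have := cmod_le_euclid (col j X) i; rewrite mxE.
Qed.

Lemma has_sup_schur_norm X :
  has_sup [set opnorm (schur_prod X Y) | Y in [set Y | opnorm Y <= 1]].
Proof.
split.
  exists (opnorm (schur_prod X 0)), 0 => //=.
  by apply: opnorm_le => v _; rewrite mul0mx euclid_norm0.
exists (rowsum_bound X) => _ [Y /= Y1 <-].
apply: opnorm_le => v /rowsum_bound_ub /le_trans; apply.
apply/ler_wsqrtr/ler_sum => i _.
rewrite lerXn2r ?nnegrE ?sumr_ge0//; do ?by move=> j _; exact: cmod_ge0.
apply: ler_sum => j _; rewrite mxE cmodM ler_piMr ?cmod_ge0//.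
exact: le_trans (cmod_le_opnorm _ _ _) Y1.
Qed.

End Boundedness.

(* Main.v *)
Require Import Defs.
From HB Require Import structures.
From mathcomp Require Import all_boot all_order all_algebra.
From mathcomp Require Import complex.
From mathcomp Require Import boolp classical_sets reals.
From mathcomp Require Import ring lra.

Set Implicit Arguments.
Unset Strict Implicit.
Unset Printing Implicit Defensive.

Import Order.TTheory GRing.Theory Num.Theory.

Local Open Scope ring_scope.
Local Open Scope complex_scope.
Local Open Scope sesquilinear_scope.

(** If some P dominates A and -A and has diagonal at most 1, then A is the
    difference of the positive matrices (P + A) / 2 and (P - A) / 2, whose
    diagonals add up to that of P.  A positive matrix is a Gram matrix B^* B,
    and Schur multiplication of Y by B^* B is a sum of compressions D^* Y D by
    diagonal matrices D made from the rows of B; so for a contraction Y it is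
    controlled by the diagonal of B^* B ([re_form_schur]).  Adding the two
    bounds shows that the Schur product of A and Y is a contraction
    ([schur_norm_le1]).

    The converse is linear programming duality.  The wanted P is a point of the
    real space of Hermitian matrices subject to the linear constraints
    tr ((P - A) S) >= 0 and tr ((P + A) T) >= 0 for S, T positive and P_ii <= 1.
    They generate a convex cone of affine functionals ([constraint]), and a
    common solution exists as soon as every constant functional in the cone is
    nonnegative; this is a finite-dimensional form of the Hahn-Banach theorem
    ([cone_extension]).  A constant functional in the cone arises from positive
    S, T whose sum is a diagonal matrix D, and its value is tr D - tr (A Z) with
    Z = S - T.  Since -D <= Z <= D, the matrix D^(-1/2) Z^T D^(-1/2) is a
    contraction Y, and tr (A Z) is the value at the vector D^(1/2) 1 of the
    quadratic form of the Schur product of A and Y; hence it is at most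
    |D^(1/2) 1|^2 = tr D ([trace_le_diag]).  Dividing by D needs positive
    entries, which a small multiple of the identity provides
    ([constraint_ge0]).

    Contractions are handled throughout by the symmetric condition
    2 Re (x^* Y y) <= |x|^2 + |y|^2 for all x and y, equivalent to having
    operator norm at most 1 ([re_form_opnorm], [opnorm_le1]).  Its left-hand
    side is linear in Y, so that bounds for the summands of a matrix add up. *)

(** * Extending a functional nonnegative on a cone *)

(** A pair (c, b) in K stands for the affine constraint b + sum c_i x_i >= 0.
    The unknowns are found one at a time.  The constraints that involve x_j
    alone among the remaining unknowns bound it from below when c_j > 0 and from
    above when c_j < 0; every lower bound is below every upper bound because
    adding two such constraints eliminates x_j and leaves a nonnegative
    constant.  Totality of K in c makes both families nonempty, so that the
    supremum of the lower bounds is a legitimate value for x_j. *)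
Lemma cone_extension (R : realType) (I : eqType) (s : seq I)
    (K : (I -> R) -> R -> Prop) :
  uniq s ->
  (forall c b c' b', K c b -> K c' b' -> K (fun i => c i + c' i) (b + b')) ->
  (forall t c b, 0 < t -> K c b -> K (fun i => t * c i) (t * b)) ->
  (forall c, exists b, K c b) ->
  (forall c b, K c b -> (forall i, i \in s -> c i = 0) -> 0 <= b) ->
  exists x : I -> R, forall c b, K c b -> 0 <= b + \sum_(i <- s) c i * x i.
Proof.
elim: s K => [|j s IHs] K /=.
  move=> _ _ _ _ K0; exists (fun=> 0) => c b Kcb.
  by rewrite big_nil addr0; apply: K0 Kcb _.
move=> /andP[js us] KD KZ Ktot K0.
pose d a : I -> R := fun i => if i == j then a else 0.
have ds a i : i \in s -> d a i = 0.
  by rewrite /d; case: eqP => // ->; rewrite (negPf js).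
(* Scaling a constraint to c j = 1 or c j = -1 turns its constant, up to sign,
   into the bound. *)
pose lo := [set y |
  exists c, [/\ K c (- y), c j = 1 & {in s, forall i, c i = 0}]]%classic.
have lo_up y c b : lo y -> K c b -> c j = -1 -> {in s, forall i, c i = 0} ->
    y <= b.
  move=> [c' [Kc' c'j c's]] Kc cj cs.
  have := K0 _ _ (KD _ _ _ _ Kc' Kc); rewrite addrC subr_ge0; apply => i.
  by rewrite inE => /orP[/eqP->|si]; rewrite ?c'j ?cj ?subrr// c's// cs// addr0.
have lo_sup : has_sup lo.
  split.
    have [b Kb] := Ktot (d 1); exists (- b), (d 1).
    by split; [rewrite opprK|rewrite /d eqxx|exact: ds].
  have [b Kb] := Ktot (d (-1)); exists b => y /lo_up/(_ Kb); apply.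
    by rewrite /d eqxx.
  exact: ds.
pose t := sup lo.
(* K' is K after the substitution x_j := t. *)
pose K' c b := exists2 b0, K c b0 & b = b0 + c j * t.
have [|||||x xP] := IHs K' => //.
- move=> c b c' b' [b0 Kc ->] [b0' Kc' ->]; exists (b0 + b0'); first exact: KD.
  by ring.
- move=> u c b u0 [b0 Kc ->]; exists (u * b0); first exact: KZ.
  by ring.
- by move=> c; have [b Kb] := Ktot c; exists (b + c j * t), b.
- move=> c b [b0 Kc ->] cs.
  have [cj|cj|cj] := ltgtP (c j) 0.
  + have cj' : 0 < - (c j)^-1 by rewrite oppr_gt0 invr_lt0.
    suff: t <= - (c j)^-1 * b0.
      rewrite -(ler_nM2l cj) mulrA mulrN divff ?lt_eqF// mulN1r.
      by rewrite -subr_ge0 addrC opprK mulrC.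
    apply: ge_sup; first by case: lo_sup.
    move=> y /lo_up; apply; first exact: KZ Kc.
      by rewrite /= mulNr mulVf// lt_eqF.
    by move=> i si; rewrite /= (cs i si) mulr0.
  + suff: - ((c j)^-1 * b0) <= t.
      rewrite -(ler_pM2l cj) mulrN mulrA divff ?gt_eqF// mul1r.
      by rewrite -subr_ge0 opprK addrC mulrC.
    apply: sup_upper_bound => //; exists (fun i => (c j)^-1 * c i); split.
    * by rewrite opprK; apply: KZ => //; rewrite invr_gt0.
    * by rewrite /= mulVf// gt_eqF.
    * by move=> i si; rewrite /= (cs i si) mulr0.
  + rewrite cj mul0r addr0; apply: K0 Kc _ => i.
    by rewrite inE => /orP[/eqP->//|/cs].
exists (fun i => if i == j then t else x i) => c b Kc.
rewrite big_cons eqxx addrA.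
suff -> : \sum_(i <- s) c i * (if i == j then t else x i) =
    \sum_(i <- s) c i * x i by apply: xP; exists b.
apply: eq_big_seq => i si; have [ij|//] := eqVneq i j.
by rewrite ij (negPf js) in si.
Qed.

(** * Real parts and the real bilinear form of a matrix *)

Section RealPart.
Variable R : realType.
Implicit Types (z w : R[i]) (t : R).

Lemma ReD z w : complex.Re (z + w) = complex.Re z + complex.Re w.
Proof. by case: z w => [a b] [c d]. Qed.

Lemma ReN z : complex.Re (- z) = - complex.Re z.
Proof. by case: z. Qed.

Lemma Re_sum (I : finType) (f : I -> R[i]) :
  complex.Re (\sum_i f i) = \sum_i complex.Re (f i).
Proof. by elim/big_rec2: _ => // i a b _ <-; rewrite ReD. Qed.

Lemma ReZ t z : complex.Re (t%:C * z) = t * complex.Re z.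
Proof. by case: z => a b /=; rewrite mul0r subr0. Qed.

Lemma Re_conj z : complex.Re (Num.conj z) = complex.Re z.
Proof. by case: z. Qed.

Lemma conj_real t : Num.conj t%:C = t%:C.
Proof. exact: conjc_real. Qed.

Lemma Re_mul_conj z : complex.Re (Num.conj z * z) = cmod z ^+ 2.
Proof.
case: z => a b; rewrite /cmod /= sqr_sqrtr ?addr_ge0 ?sqr_ge0//.
by rewrite mulNr opprK !expr2.
Qed.

Lemma Re_le_cmod z : complex.Re z <= cmod z.
Proof.
case: z => a b; apply: le_trans (ler_norm _) _.
by rewrite -sqrtr_sqr ler_wsqrtr//= lerDl sqr_ge0.
Qed.

Lemma cmod_real t : cmod t%:C = `|t|.
Proof. by rewrite /cmod /= expr0n addr0 sqrtr_sqr. Qed.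

Lemma cmod_conj z : cmod (Num.conj z) = cmod z.
Proof. by case: z => a b; rewrite /cmod /= sqrrN. Qed.

End RealPart.

Section Forms.
Variables (R : realType) (n : nat).
Implicit Types (X Y Z P : 'M[R[i]]_n) (x y v : 'cV[R[i]]_n) (t : R).

(** Only real parts are kept: this makes every estimate an inequality between
    real numbers, and replacing x by a multiple of modulus 1 recovers the
    modulus of x^* Z y. *)
Definition re_form Z x y : R := complex.Re ((x ^t* *m Z *m y) 0 0).

Definition sqnorm v : R := \sum_i cmod (v i 0) ^+ 2.

Lemma re_formE Z x y : re_form Z x y =
  \sum_i \sum_j complex.Re (Num.conj (x i 0) * Z i j * y j 0).
Proof.
rewrite /re_form -mulmxA mxE Re_sum; apply: eq_bigr => i _.
rewrite !mxE big_distrr Re_sum; apply: eq_bigr => j _ /=.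
by rewrite mulrA.
Qed.

Lemma re_formDm X Y x y : re_form (X + Y) x y = re_form X x y + re_form Y x y.
Proof. by rewrite /re_form mulmxDr mulmxDl mxE ReD. Qed.

Lemma re_formNm X x y : re_form (- X) x y = - re_form X x y.
Proof. by rewrite /re_form mulmxN mulNmx mxE ReN. Qed.

Lemma re_formZm t X x y : re_form (t%:C *: X) x y = t * re_form X x y.
Proof. by rewrite /re_form -scalemxAr -scalemxAl mxE ReZ. Qed.

Lemma re_formDr Z x y v : re_form Z x (y + v) = re_form Z x y + re_form Z x v.
Proof. by rewrite /re_form mulmxDr mxE ReD. Qed.

Lemma re_formNr Z x y : re_form Z x (- y) = - re_form Z x y.
Proof. by rewrite /re_form mulmxN mxE ReN. Qed.

Lemma re_formZr t Z x y : re_form Z x (t%:C *: y) = t * re_form Z x y.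
Proof. by rewrite /re_form -scalemxAr mxE ReZ. Qed.

Lemma re_formDl Z x y v : re_form Z (x + y) v = re_form Z x v + re_form Z y v.
Proof. by rewrite /re_form linearD map_mxD !mulmxDl mxE ReD. Qed.

Lemma re_formNl Z x y : re_form Z (- x) y = - re_form Z x y.
Proof. by rewrite /re_form linearN map_mxN !mulNmx mxE ReN. Qed.

Lemma re_formZl t Z x y : re_form Z (t%:C *: x) y = t * re_form Z x y.
Proof.
by rewrite /re_form linearZ map_mxZ /= conj_real -!scalemxAl mxE ReZ.
Qed.

Lemma re_form_mulmx X Y x y : re_form (X *m Y) x y = re_form X x (Y *m y).
Proof. by rewrite /re_form !mulmxA. Qed.

Lemma hermE X : X \is hermsymmx -> forall i j, X i j = Num.conj (X j i).
Proof.
by move=> /is_hermitianmxP; rewrite expr0 scale1r => {1}-> i j; rewrite !mxE.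
Qed.

Lemma hermP X : (forall i j, X i j = Num.conj (X j i)) -> X \is hermsymmx.
Proof.
move=> XE; apply/is_hermitianmxP; rewrite expr0 scale1r.
by apply/matrixP => i j; rewrite !mxE.
Qed.

Lemma hermD X Y : X \is hermsymmx -> Y \is hermsymmx -> X + Y \is hermsymmx.
Proof.
move=> hX hY; apply: hermP => i j.
by rewrite !mxE rmorphD /= -(hermE hX) -(hermE hY).
Qed.

Lemma hermN X : X \is hermsymmx -> - X \is hermsymmx.
Proof.
by move=> hX; apply: hermP => i j; rewrite !mxE rmorphN /= -(hermE hX).
Qed.

Lemma re_formC X x y : X \is hermsymmx -> re_form X x y = re_form X y x.
Proof.
move=> hX; rewrite !re_formE exchange_big; apply: eq_bigr => i _.
apply: eq_bigr => j _; rewrite -Re_conj !rmorphM /= conjCK -(hermE hX).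
by congr complex.Re; ring.
Qed.

Lemma Im_herm_form X v : X \is hermsymmx ->
  complex.Im ((v ^t* *m X *m v) 0 0) = 0.
Proof.
move=> hX; set z := _ 0 0.
suff : Num.conj z = z by case: z => a b [] /=; lra.
rewrite /z -mulmxA mxE rmorph_sum /=.
under eq_bigr do rewrite !mxE rmorphM /= conjCK rmorph_sum big_distrr /=.
rewrite exchange_big; apply: eq_bigr => i _; rewrite !mxE big_distrr /=.
by apply: eq_bigr => j _; rewrite rmorphM /= -(hermE hX); ring.
Qed.

Lemma psdmxP P :
  psdmx P <-> P \is hermsymmx /\ forall v, 0 <= re_form P v v.
Proof.
split=> -[hP P0]; split=> // v; have := P0 v; rewrite /re_form lecE /= => P0v.
  by case/andP: P0v.
by rewrite Im_herm_form// eqxx.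
Qed.

Lemma re_form1 v : re_form 1%:M v v = sqnorm v.
Proof.
rewrite /re_form mulmx1 mxE Re_sum; apply: eq_bigr => i _.
by rewrite !mxE Re_mul_conj.
Qed.

End Forms.

(** * Positive matrices and contractions *)

Section Psd.
Variables (R : realType) (n : nat).
Implicit Types (Y P S T A : 'M[R[i]]_n) (x y v : 'cV[R[i]]_n) (t : R).

Lemma psdmxD S T : psdmx S -> psdmx T -> psdmx (S + T).
Proof.
move=> /psdmxP[hS S0] /psdmxP[hT T0]; apply/psdmxP; split=> [|v].
  exact: hermD.
by rewrite re_formDm addr_ge0.
Qed.

Lemma psdmxZ t S : 0 <= t -> psdmx S -> psdmx (t%:C *: S).
Proof.
move=> t0 /psdmxP[hS S0]; apply/psdmxP; split=> [|v].
  by apply: hermP => i j; rewrite !mxE rmorphM /= conj_real -(hermE hS).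
by rewrite re_formZm mulr_ge0.
Qed.

Lemma psdmx_outer v : psdmx (v *m v ^t*).
Proof.
apply/psdmxP; split=> [|x].
  by apply: hermP => i j; rewrite !mxE !big_ord1 !mxE rmorphM /= conjCK mulrC.
rewrite /re_form mulmxA -mulmxA mxE big_ord1.
suff -> : (x^t* *m v) 0 0 = Num.conj ((v^t* *m x) 0 0).
  by rewrite Re_mul_conj sqr_ge0.
rewrite !mxE rmorph_sum; apply: eq_bigr => i _.
by rewrite !mxE rmorphM /= conjCK mulrC.
Qed.

Lemma psdmx0 : psdmx (0 : 'M[R[i]]_n).
Proof.
apply/psdmxP; split=> [|v]; first by apply: hermP => i j; rewrite !mxE rmorph0.
by rewrite /re_form mulmx0 mul0mx mxE.
Qed.

(** Polarisation: 4 Re (x^* A y) is the difference of the values of A at x + y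
    and x - y.  Bounding them by P through P - A and P + A respectively leaves
    the parallelogram sum 2 (x^* P x + y^* P y). *)
Lemma re_form_psd_bound P A x y : A \is hermsymmx ->
  psdmx (P - A) -> psdmx (P + A) ->
  re_form A x y <= (re_form P x x + re_form P y y) / 2.
Proof.
move=> hA /psdmxP[_ /(_ (x + y)) h1] /psdmxP[_ /(_ (x - y)) h2].
move: h1 h2; rewrite !re_formDm !re_formNm !(re_formDr, re_formDl).
rewrite !(re_formNr, re_formNl) (re_formC y x hA).
move: (re_form A x x) (re_form A x y) (re_form A y y) => a b c.
move: (re_form P x x) (re_form P x y) (re_form P y x) (re_form P y y) => *.
lra.
Qed.

Lemma sqnorm_ge0 v : 0 <= sqnorm v.
Proof. by apply: sumr_ge0 => i _; rewrite sqr_ge0. Qed.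

Lemma sqnormZ t v : sqnorm (t%:C *: v) = t ^+ 2 * sqnorm v.
Proof. by rewrite -!re_form1 re_formZl re_formZr mulrA expr2. Qed.

Lemma sqnormN v : sqnorm (- v) = sqnorm v.
Proof. by rewrite -!re_form1 re_formNl re_formNr opprK. Qed.

Lemma sqnorm_eq0 v : sqnorm v = 0 -> v = 0.
Proof.
move=> /eqP; rewrite psumr_eq0 => [/allP v0|i _]; last by rewrite sqr_ge0.
apply/matrixP => i j; rewrite ord1 mxE; apply: Normc.eq0_normc.
by apply/eqP; rewrite -sqrf_eq0 (implyP (v0 i _))// mem_index_enum.
Qed.

Lemma opnorm_ge0 Y : 0 <= opnorm Y.
Proof.
by have := opnorm_ub Y (v := 0); rewrite mulmx0 euclid_norm0 ler01; apply.
Qed.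

Lemma sqnorm_mulmx Y v : sqnorm (Y *m v) <= opnorm Y ^+ 2 * sqnorm v.
Proof.
have [v0|v0] := eqVneq (sqnorm v) 0.
  rewrite (sqnorm_eq0 v0) mulmx0 -re_form1 /re_form mulmx0 mxE.
  by rewrite mulr_ge0 ?sqr_ge0 ?sqnorm_ge0.
have v1 : 0 < sqnorm v by rewrite lt_def v0 sqnorm_ge0.
pose s := Num.sqrt (sqnorm v).
have s2 : s ^+ 2 = sqnorm v by rewrite sqr_sqrtr// sqnorm_ge0.
have s0 : s != 0 by rewrite -sqrf_eq0 s2.
have /(opnorm_ub Y) : euclid_norm (s^-1%:C *: v) <= 1.
  by rewrite /euclid_norm -/(sqnorm _) sqnormZ exprVn s2 mulVf// sqrtr1.
rewrite -scalemxAr => h.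
have := lerXn2r 2 _ _ h; rewrite !nnegrE sqrtr_ge0 => /(_ isT).
rewrite (le_trans _ h) ?sqrtr_ge0// => /(_ isT).
rewrite /euclid_norm -/(sqnorm _) sqr_sqrtr ?sqnorm_ge0// -/(sqnorm _).
by rewrite sqnormZ exprVn s2 mulrC ler_pdivrMr.
Qed.

(** The expansion of |t x - Y y|^2 >= 0, with |Y y| <= t |y|. *)
Lemma re_form_opnorm Y t x y : 0 < t -> opnorm Y <= t ->
  re_form Y x y <= t * (sqnorm x + sqnorm y) / 2.
Proof.
move=> t0 Yt.
have := sqnorm_ge0 (t%:C *: x - Y *m y).
rewrite -re_form1 !(re_formDr, re_formDl, re_formNr, re_formNl).
rewrite !(re_formZl, re_formZr) (re_formC (Y *m y) x); last first.
  by apply: hermP => i j; rewrite !mxE eq_sym rmorph_nat.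
rewrite !re_form1 -re_form_mulmx mul1mx => h.
have h' : sqnorm (Y *m y) <= t ^+ 2 * sqnorm y.
  apply: le_trans (sqnorm_mulmx _ _) _; rewrite ler_wpM2r ?sqnorm_ge0//.
  by rewrite lerXn2r ?nnegrE ?opnorm_ge0// ltW.
rewrite -(ler_pM2l t0); lra.
Qed.

(** The choice x = Y v turns the hypothesis into
    2 |Y v|^2 <= |Y v|^2 + |v|^2. *)
Lemma opnorm_le1 Y :
  (forall x y, re_form Y x y <= (sqnorm x + sqnorm y) / 2) -> opnorm Y <= 1.
Proof.
move=> YP; apply: opnorm_le => v v1; apply: le_trans v1; apply: ler_wsqrtr.
have := YP (Y *m v) v; rewrite -[Y in re_form Y]mul1mx re_form_mulmx re_form1.
rewrite -!/(sqnorm _); lra.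
Qed.

End Psd.

(** * Real diagonal matrices *)

Section RealDiagonal.
Variables (R : realType) (n : nat).
Implicit Types (X W : 'M[R[i]]_n) (v : 'cV[R[i]]_n) (t : R) (d m : 'I_n -> R).

Definition real_diag d : 'M[R[i]]_n := diag_mx (\row_i (d i)%:C).

Lemma real_diagD d m :
  real_diag (fun i => d i + m i) = real_diag d + real_diag m.
Proof.
by apply/matrixP => i j; rewrite !mxE -mulrnDl; congr (_ *+ _); rewrite rmorphD.
Qed.

Lemma real_diagZ t d : real_diag (fun i => t * d i) = t%:C *: real_diag d.
Proof. by apply/matrixP => i j; rewrite !mxE rmorphM mulrnAr. Qed.

Lemma re_form_diag d v :
  re_form (real_diag d) v v = \sum_i d i * cmod (v i 0) ^+ 2.
Proof.
rewrite re_formE; apply: eq_bigr => i _.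
rewrite (bigD1 i)//= big1 ?addr0 => [|j ji].
  by rewrite !mxE eqxx mulr1n mulrAC mulrC ReZ Re_mul_conj.
by rewrite !mxE eq_sym (negPf ji) mulr0n mulr0 mul0r.
Qed.

Lemma trace_mulmx_diag X d :
  complex.Re (\tr (X *m real_diag d)) = \sum_i d i * complex.Re (X i i).
Proof.
rewrite mul_mx_diag Re_sum; apply: eq_bigr => i _.
by rewrite !mxE mulrC ReZ.
Qed.

Lemma psdmx_diag d : (forall i, 0 <= d i) -> psdmx (real_diag d).
Proof.
move=> d0; apply/psdmxP; split=> [|v].
  apply: hermP => i j; rewrite !mxE eq_sym rmorphMn /= conj_real.
  by case: eqP => // ->.
by rewrite re_form_diag sumr_ge0// => i _; rewrite mulr_ge0 ?sqr_ge0.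
Qed.

(** Every Hermitian matrix becomes positive after adding a large multiple of the
    identity; this provides the constraints with prescribed linear part in
    [constraint_total]. *)
Lemma herm_shift_psdmx W : W \is hermsymmx ->
  psdmx (W + real_diag (fun=> opnorm W + 1)).
Proof.
move=> hW; have W1 : 0 < opnorm W + 1 by rewrite ltr_wpDl ?opnorm_ge0.
have [hD _] := @psdmx_diag (fun=> opnorm W + 1) (fun=> ltW W1).
apply/psdmxP; split=> [|v]; first exact: hermD.
rewrite re_formDm re_form_diag -mulr_sumr -/(sqnorm v).
have := @re_form_opnorm _ _ W (opnorm W + 1) v (- v).
by rewrite re_formNr sqnormN lerDl ler01 W1 => /(_ isT isT); lra.
Qed.

End RealDiagonal.

(** * Schur multiplication by a dominated matrix *)

Section Schur.
Variables (R : realType) (n : nat).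
Implicit Types (Y P S A : 'M[R[i]]_n) (x y v : 'cV[R[i]]_n).

(** Unitary diagonalisation S = U^* D U with D >= 0 gives B = D^(1/2) U. *)
Lemma psdmx_gram S : psdmx S -> exists B : 'M[R[i]]_n, S = B ^t* *m B.
Proof.
move=> [hS S0]; have /orthomx_spectralP SE := hermitian_normalmx hS.
set U := spectralmx S in SE; set d := spectral_diag S in SE.
have Uu : U \is unitarymx := spectral_unitarymx S.
rewrite invmx_unitary// in SE.
have dE : diag_mx d = U *m S *m U^t*.
  by rewrite SE !mulmxA (unitarymxP Uu) mul1mx -mulmxA (unitarymxP Uu) mulmx1.
have d0 k : 0 <= d 0 k.
  have := S0 ((row k U)^t*); rewrite trmxCK -row_mul.
  suff -> : (row k (U *m S) *m (row k U)^t*) 0 0 = diag_mx d k k.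
    by rewrite mxE eqxx mulr1n.
  by rewrite dE !mxE; apply: eq_bigr => i _; rewrite !mxE.
pose r : 'rV[R[i]]_n := \row_k sqrtC (d 0 k); exists (diag_mx r *m U).
rewrite trmx_mul map_mxM tr_diag_mx map_diag_mx mulmxA -(mulmxA _ (diag_mx _)).
rewrite mulmx_diag {1}SE.
suff -> : \row_k (map_mx Num.conj r 0 k * r 0 k) = d by [].
by apply/rowP => k; rewrite !mxE geC0_conj ?sqrtC_ge0// -expr2 sqrtCK.
Qed.

(** With S = B^* B, the form of the Schur product of S and Y at (x, y) is the
    sum over k of the form of Y at (b_k x, b_k y), where b_k x is the entrywise
    product of x with row k of B.  Each term obeys the contraction inequality,
    and the sum over k of |b_k x|^2 only involves the diagonal of S. *)
Lemma re_form_schur S Y x y : psdmx S -> opnorm Y <= 1 ->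
  re_form (schur_prod S Y) x y <=
  \sum_i complex.Re (S i i) * ((cmod (x i 0) ^+ 2 + cmod (y i 0) ^+ 2) / 2).
Proof.
move=> /psdmx_gram[B ->] Y1.
pose w k v : 'cV[R[i]]_n := \col_i (B k i * v i 0).
have -> : re_form (schur_prod (B^t* *m B) Y) x y =
    \sum_k re_form Y (w k x) (w k y).
  under [RHS]eq_bigr do rewrite re_formE.
  rewrite re_formE [RHS]exchange_big; apply: eq_bigr => i _.
  rewrite [RHS]exchange_big; apply: eq_bigr => j _; rewrite -Re_sum.
  congr complex.Re; rewrite !mxE big_distrl big_distrr big_distrl /=.
  by apply: eq_bigr => k _; rewrite !mxE rmorphM /=; ring.
have wE v : \sum_k sqnorm (w k v) =
    \sum_i complex.Re ((B^t* *m B) i i) * cmod (v i 0) ^+ 2.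
  rewrite exchange_big; apply: eq_bigr => i _; rewrite mxE Re_sum big_distrl /=.
  by apply: eq_bigr => k _; rewrite !mxE Re_mul_conj cmodM exprMn.
apply: le_trans (_ : \sum_k (sqnorm (w k x) + sqnorm (w k y)) / 2 <= _).
  apply: ler_sum => k _.
  by apply: le_trans (re_form_opnorm _ _ ltr01 Y1) _; rewrite mul1r.
rewrite -mulr_suml big_split !wE /= -big_split mulr_suml /=.
by apply: ler_sum => i _; rewrite mulrA mulrDr.
Qed.

Lemma schur_norm_le1 A :
  (exists P, [/\ psdmx P, loewner_le (- P) A, loewner_le A P &
                diag_norm P <= 1]) ->
  schur_norm A <= 1.
Proof.
move=> [P [P0 AP1 AP2 P1]].
apply: ge_sup; first by case: (has_sup_schur_norm A).
move=> _ [Y /= Y1 <-]; apply: opnorm_le1 => x y.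
rewrite /loewner_le opprK in AP1 AP2.
have Y1N : opnorm (- Y) <= 1.
  apply: opnorm_le1 => u v; rewrite re_formNm -re_formNr.
  apply: le_trans (re_form_opnorm _ _ ltr01 Y1) _.
  by rewrite mul1r -(sqnormN v).
have h1 := re_form_schur x y AP1 Y1.
have h2 := re_form_schur x y AP2 Y1N.
(* Twice A is (P + A) - (P - A); the sign is moved onto Y, so that both
   multipliers are positive. *)
have AE : schur_prod (A + P) Y + schur_prod (P - A) (- Y) =
    schur_prod A Y + schur_prod A Y.
  by apply/matrixP => i j; rewrite !mxE; ring.
have := lerD h1 h2; rewrite -re_formDm AE re_formDm => h.
rewrite ler_pdivlMr// mulr_natr mulr2n; apply: le_trans h _.
rewrite -!big_split /=; apply: ler_sum => i _; rewrite -mulrDl -ReD !mxE.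
have -> : A i i + P i i + (P i i - A i i) = P i i + P i i by ring.
have Pi1 : complex.Re (P i i) <= 1.
  apply: le_trans (Re_le_cmod _) _; apply: le_trans P1.
  exact: (le_bigmax _ (fun j => cmod (P j j)) i).
rewrite ReD mulrDl -mulrDr -splitr.
by rewrite ler_piMl// addr_ge0 ?sqr_ge0.
Qed.
End Schur.

(** * The dual bound *)

Section DualBound.
Variables (R : realType) (n : nat).
Implicit Types (A Z : 'M[R[i]]_n) (v : 'cV[R[i]]_n) (d : 'I_n -> R).

(** For D = diag d, the matrix Y = D^(-1/2) Z^T D^(-1/2) is a contraction since
    -D <= Z <= D, and tr (A Z) is the value at D^(1/2) 1 of the form of the
    Schur product of A and Y.  The vector D^(1/2) 1 has squared norm tr D. *)
Lemma trace_le_diag A Z d : schur_norm A <= 1 -> Z \is hermsymmx ->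
  (forall i, 0 < d i) -> psdmx (real_diag d - Z) -> psdmx (real_diag d + Z) ->
  complex.Re (\tr (A *m Z)) <= \sum_i d i.
Proof.
move=> A1 hZ d0 dmZ dpZ; pose q i := Num.sqrt (d i).
have q0 i : q i != 0 by rewrite gt_eqF// sqrtr_gt0.
have q2 i : q i ^+ 2 = d i by rewrite sqr_sqrtr// ltW.
pose Y : 'M[R[i]]_n := \matrix_(i, j) ((q i)^-1%:C * Z j i * (q j)^-1%:C).
have Y1 : opnorm Y <= 1.
  apply: opnorm_le1 => x y.
  (* Conjugating and exchanging x and y absorbs the transposition in Y. *)
  pose w v : 'cV[R[i]]_n := \col_i ((q i)^-1%:C * Num.conj (v i 0)).
  have -> : re_form Y x y = re_form Z (w y) (w x).
    rewrite !re_formE exchange_big; apply: eq_bigr => i _.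
    apply: eq_bigr => j _.
    by rewrite !mxE rmorphM /= conj_real conjCK; congr complex.Re; ring.
  have wE v : re_form (real_diag d) (w v) (w v) = sqnorm v.
    rewrite re_form_diag; apply: eq_bigr => i _.
    rewrite mxE cmodM exprMn cmod_conj cmod_real real_normK ?num_real//.
    by rewrite exprVn q2 mulrA mulfV ?mul1r// gt_eqF.
  by rewrite addrC -!wE; apply: re_form_psd_bound.
pose u : 'cV[R[i]]_n := \col_i (q i)%:C.
have -> : complex.Re (\tr (A *m Z)) = re_form (schur_prod A Y) u u.
  rewrite Re_sum re_formE; apply: eq_bigr => i _; rewrite mxE Re_sum.
  apply: eq_bigr => j _; rewrite !mxE conj_real !fmorphV /=.
  congr complex.Re; field.
  by rewrite !fmorph_eq0 !q0.
have AY1 : opnorm (schur_prod A Y) <= 1.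
  apply: le_trans A1; apply: (sup_upper_bound (has_sup_schur_norm A)).
  by exists Y.
apply: le_trans (re_form_opnorm _ _ ltr01 AY1) _.
rewrite mul1r mulrDl -splitr; apply: ler_sum => i _.
by rewrite mxE cmod_real real_normK ?num_real// q2.
Qed.

End DualBound.

(** * Real coordinates on Hermitian matrices *)

Section HermitianCoordinates.
Variables (R : realType) (n : nat).
Implicit Types (X Y W : 'M[R[i]]_n) (v : 'cV[R[i]]_n) (t : R).
Implicit Types (c : 'I_n * 'I_n -> R) (p : 'I_n * 'I_n).

(** The n^2 real coordinates of a Hermitian W are the numbers Re W_ij - Im W_ij:
    the positions (i, j) and (j, i) give the difference and the sum of the real
    and imaginary parts of W_ij.  Unlike a list of diagonal entries followed by
    real and imaginary parts above the diagonal, this treats all positions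
    alike, and by [trace_herm_of] it is an isometry for the trace form. *)
Definition herm_of c : 'M[R[i]]_n :=
  \matrix_(i, j) (((c (i, j) + c (j, i)) / 2) +i* ((c (j, i) - c (i, j)) / 2)).

Definition herm_coord W p : R :=
  complex.Re (W p.1 p.2) - complex.Im (W p.1 p.2).

Lemma herm_of_hermsymmx c : herm_of c \is hermsymmx.
Proof.
apply: hermP => i j; rewrite !mxE; apply/eqP; rewrite eq_complex /=.
by rewrite addrC eqxx -mulNr opprB eqxx.
Qed.

Lemma herm_ofK c p : herm_coord (herm_of c) p = c p.
Proof. by case: p => i j; rewrite /herm_coord mxE /=; lra. Qed.

Lemma herm_ReIm W i j : W \is hermsymmx ->
  complex.Re (W j i) = complex.Re (W i j) /\
  complex.Im (W j i) = - complex.Im (W i j).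
Proof. by move=> hW; rewrite (hermE hW j i); case: (W i j). Qed.

Lemma herm_coord_eq0 W : W \is hermsymmx ->
  (forall p, herm_coord W p = 0) -> W = 0.
Proof.
move=> hW W0; apply/matrixP => i j; rewrite mxE; apply/eqP.
rewrite eq_complex /=.
have := W0 (j, i); have := W0 (i, j); rewrite /herm_coord /=.
have [-> ->] := herm_ReIm i j hW => *.
by apply/andP; split; apply/eqP; lra.
Qed.

(** Summed over the positions (i, j) and (j, i), the trace is symmetric, while
    the right-hand side is only so after averaging it with its transpose. *)
Lemma trace_herm_of c W : W \is hermsymmx ->
  complex.Re (\tr (herm_of c *m W)) = \sum_p herm_coord W p * c p.
Proof.
move=> hW; pose f i j := herm_coord W (i, j) * c (i, j).
have -> : \sum_p herm_coord W p * c p =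
    (\sum_i \sum_j f i j + \sum_i \sum_j f j i) / 2.
  rewrite [X in _ + X]exchange_big mulrDl -splitr.
  by rewrite pair_big; apply: eq_bigr => -[].
rewrite Re_sum -big_split mulr_suml; apply: eq_bigr => i _ /=.
rewrite mxE Re_sum -big_split mulr_suml; apply: eq_bigr => j _ /=.
rewrite mxE /f /herm_coord /=; have [-> ->] := herm_ReIm j i hW.
by case: (W j i) => a b /=; lra.
Qed.

Lemma herm_coordD X Y p :
  herm_coord (X + Y) p = herm_coord X p + herm_coord Y p.
Proof.
by rewrite /herm_coord mxE; case: (X _ _) (Y _ _) => [a b] [a' b'] /=; ring.
Qed.

Lemma herm_coordZ t X p : herm_coord (t%:C *: X) p = t * herm_coord X p.
Proof. by rewrite /herm_coord mxE; case: (X _ _) => a b /=; ring. Qed.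

Lemma trace_outer W v : complex.Re (\tr (W *m (v *m v ^t*))) = re_form W v v.
Proof. by rewrite mulmxA mxtrace_mulC mulmxA /re_form {1}/mxtrace big_ord1. Qed.

End HermitianCoordinates.

(** * Existence of a dominating matrix *)

Section Duality.
Variables (R : realType) (n : nat).
Implicit Types (A P S T : 'M[R[i]]_n) (v : 'cV[R[i]]_n) (t b : R).
Implicit Types (d : 'I_n -> R) (c : 'I_n * 'I_n -> R).

(** For P Hermitian, the number
    tr (P (S + T - diag d)) + sum d - tr (A (S - T)) equals
    tr ((P - A) S) + tr ((P + A) T) + sum_i d_i (1 - P_ii).  The matrix is the
    linear part of this functional of P and [constraint_cst] its constant. *)
Definition constraint_mx S T d : 'M[R[i]]_n := S + T - real_diag d.

Definition constraint_cst A S T d : R :=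
  \sum_i d i - complex.Re (\tr (A *m (S - T))).

Definition constraint A c (b : R) : Prop := exists S T d,
  [/\ psdmx S, psdmx T, forall i, 0 <= d i,
      forall p, c p = herm_coord (constraint_mx S T d) p &
      b = constraint_cst A S T d].

Lemma constraintD A c b c' b' : constraint A c b -> constraint A c' b' ->
  constraint A (fun p => c p + c' p) (b + b').
Proof.
move=> [S [T [d [S0 T0 d0 cE bE]]]] [S' [T' [d' [S'0 T'0 d'0 c'E b'E]]]].
exists (S + S'), (T + T'), (fun i => d i + d' i).
split=> [||i|p|]; [exact: psdmxD|exact: psdmxD|exact: addr_ge0| |].
  rewrite cE c'E -herm_coordD /constraint_mx real_diagD.
  congr herm_coord; move: (real_diag d) (real_diag d') => D D'.
  by apply/matrixP => i j; rewrite !mxE; ring.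
rewrite bE b'E /constraint_cst big_split /= opprD !mulmxDr !mulmxN.
by rewrite !(raddfD, raddfN) /=; ring.
Qed.

Lemma constraintZ A t c b : 0 < t -> constraint A c b ->
  constraint A (fun p => t * c p) (t * b).
Proof.
move=> /ltW t0 [S [T [d [S0 T0 d0 cE ->]]]].
exists (t%:C *: S), (t%:C *: T), (fun i => t * d i).
split=> [||i|p|]; [exact: psdmxZ|exact: psdmxZ|exact: mulr_ge0| |].
  by rewrite cE -herm_coordZ /constraint_mx real_diagZ scalerBr scalerDr.
rewrite /constraint_cst -mulr_sumr -scalerBr -scalemxAr mxtraceZ ReZ.
by rewrite mulrBr.
Qed.

Lemma constraint_total A c : exists b, constraint A c b.
Proof.
pose d : 'I_n -> R := fun=> opnorm (herm_of c) + 1.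
exists (constraint_cst A (herm_of c + real_diag d) 0 d).
exists (herm_of c + real_diag d), 0, d; split=> // [||i|p].
- exact/herm_shift_psdmx/herm_of_hermsymmx.
- exact: psdmx0.
- exact: addr_ge0 (opnorm_ge0 _) ler01.
- by rewrite /constraint_mx addr0 addrK herm_ofK.
Qed.

(** If the linear part vanishes then S + T = diag d, hence
    -diag d <= S - T <= diag d and [trace_le_diag] applies, after adding an
    arbitrarily small constant to d to make it positive. *)
Lemma constraint_ge0 A c b : schur_norm A <= 1 -> constraint A c b ->
  (forall p, c p = 0) -> 0 <= b.
Proof.
move=> A1 [S [T [d [S0 T0 d0 cE ->]]]] c0.
have [hS _] := S0; have [hT _] := T0; have [hd _] := psdmx_diag d0.
have STd : S + T = real_diag d.
  apply/eqP; rewrite -subr_eq0; apply/eqP; apply: herm_coord_eq0 => [|p].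
    exact: hermD (hermD _ _) (hermN _).
  by rewrite -cE.
rewrite subr_ge0; apply/ler_addgt0Pr => e e0.
pose e' := e / n.+1%:R.
have e'0 : 0 < e' by rewrite divr_gt0.
have hZ : S - T \is hermsymmx by exact: hermD (hermN _).
have psd_e : psdmx (real_diag (fun _ : 'I_n => e')).
  by apply: psdmx_diag => i; exact: ltW.
apply: le_trans (_ : \sum_i (d i + e') <= _).
  apply: (trace_le_diag A1 hZ) => [i||]; first by rewrite ltr_wpDl.
    have -> : real_diag (fun i => d i + e') - (S - T) =
        T + T + real_diag (fun=> e').
      rewrite real_diagD -STd; move: (real_diag _) => D.
      by apply/matrixP => i j; rewrite !mxE; ring.
    exact: psdmxD (psdmxD _ _) _.
  have -> : real_diag (fun i => d i + e') + (S - T) =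
      S + S + real_diag (fun=> e').
    rewrite real_diagD -STd; move: (real_diag _) => D.
    by apply/matrixP => i j; rewrite !mxE; ring.
  exact: psdmxD (psdmxD _ _) _.
rewrite big_split sumr_const card_ord /= lerD2l.
have -> : e = e' *+ n.+1 by rewrite -[RHS]mulr_natr /e' mulfVK ?pnatr_eq0.
by rewrite mulrS lerDr ltW.
Qed.

(** A solution of all constraints is the required matrix: testing it on rank one
    S gives P - A >= 0, on rank one T gives P + A >= 0, and on a basis vector d
    gives P_kk <= 1. *)
Lemma schur_norm_le1_dominated A : A \is hermsymmx -> schur_norm A <= 1 ->
  exists P, [/\ psdmx P, loewner_le (- P) A, loewner_le A P & diag_norm P <= 1].
Proof.
move=> hA A1.
have [|x xP] := cone_extension (index_enum_uniq _) (@constraintD A)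
  (@constraintZ A) (constraint_total A).
  move=> c b cb c0; apply: constraint_ge0 cb _ => // p.
  by rewrite c0// mem_index_enum.
pose P := herm_of x.
have hP : P \is hermsymmx := herm_of_hermsymmx x.
have PST S T d : psdmx S -> psdmx T -> (forall i, 0 <= d i) ->
    0 <= constraint_cst A S T d + complex.Re (\tr (P *m (constraint_mx S T d))).
  move=> S0 T0 d0; rewrite trace_herm_of.
    by apply: xP; exists S, T, d.
  have [hS _] := S0; have [hT _] := T0; have [hd _] := psdmx_diag d0.
  exact: hermD (hermD _ _) (hermN _).
have zero_diag : real_diag (fun=> 0 : R) = 0 :> 'M[R[i]]_n.
  by apply/matrixP => i j; rewrite !mxE mul0rn.
have PmA : psdmx (P - A).
  apply/psdmxP; split=> [|v]; first exact: hermD (hermN _).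
  have := PST _ _ (fun=> 0) (psdmx_outer v) (psdmx0 _ _) (fun=> lexx _).
  rewrite /constraint_cst /constraint_mx zero_diag subr0 subr0 addr0 big1//.
  by rewrite sub0r addrC !trace_outer re_formDm re_formNm.
have PpA : psdmx (P + A).
  apply/psdmxP; split=> [|v]; first exact: hermD.
  have := PST _ _ (fun=> 0) (psdmx0 _ _) (psdmx_outer v) (fun=> lexx _).
  rewrite /constraint_cst /constraint_mx zero_diag subr0 sub0r add0r big1//.
  by rewrite sub0r mulmxN raddfN ReN opprK addrC !trace_outer re_formDm.
have P0 : psdmx P.
  have [_ dm] := (psdmxP _).1 PmA; have [_ dp] := (psdmxP _).1 PpA.
  apply/psdmxP; split=> [|v]; first exact: hP.
  have := addr_ge0 (dm v) (dp v).
  by rewrite !re_formDm re_formNm addrACA addNr addr0 -mulr2n pmulrn_lge0.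
exists P; split; [exact: P0| |exact: PmA|].
  by rewrite /loewner_le opprK addrC; exact: PpA.
apply: bigmax_le => [|k _]; first exact: ler01.
have Pkk : P k k = (complex.Re (P k k))%:C.
  by have := hermE hP k k; case: (P k k) => a b [] /= bN; congr Complex; lra.
have P1 : complex.Re (P k k) <= 1.
  have := PST 0 0 (fun i => (i == k)%:R) (psdmx0 _ _) (psdmx0 _ _)
    (fun=> ler0n _ _).
  rewrite /constraint_cst /constraint_mx subr0 addr0 sub0r mulmx0 mulmxN.
  rewrite mxtrace0 subr0 raddfN ReN trace_mulmx_diag -sumrB.
  rewrite (bigD1 k)//= big1 => [|i /negPf->]; last by rewrite mul0r subrr.
  by rewrite eqxx mul1r addr0 subr_ge0.
have Pk0 : 0 <= complex.Re (P k k).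
  have [_ /(_ (delta_mx k 0))] := (psdmxP _).1 P0.
  by rewrite /re_form -map_trmx map_delta_mx trmx_delta -rowE -colE !mxE.
by rewrite Pkk cmod_real ger0_norm.
Qed.

End Duality.

Theorem theorem2p2 (R : realType) (n : nat) (A : 'M[R[i]]_n)
    (hA : A \is hermsymmx) :
  schur_norm A <= 1 <->
  exists P : 'M[R[i]]_n,
    [/\ psdmx P, loewner_le (- P) A, loewner_le A P & diag_norm P <= 1].
Proof.
split; [exact: schur_norm_le1_dominated|exact: schur_norm_le1].
Qed.
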